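(* There exist an irrational real number $\theta$ and an analytic function $f(z)$ on the open unit disc $\mathbb{D}=\{z\in\mathbb{C}\mid |z|<1\}$ with the following property: putting $a_1=\frac12$ and $a_2=\frac12 e^{2\pi i\theta}$, the set $\{n\in\mathbb{Z}_+\mid f(a_1^n)=a_2^n\}$ is infinite but very sparse.
   Context: $\mathbb{Z}_+$ is the set of positive integers and $\mathbb{N}=\mathbb{Z}_+\cup\{0\}$. A subset $A\subseteq\mathbb{N}$ is very sparse if, for each $m\in\mathbb{Z}_+$, $|A\cap[0,n]|=o(\log^{(m)}(n))$ as $n\to\infty$, where $\log^{(m)}$ is the $m$-th iterated logarithm. *)

(* Defs.v *)
From Stdlib Require Import Reals List QArith Qreals ClassicalEpsilon.
From Stdlib Require Finite_sets.
From Coquelicot Require Import Coquelicot.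

Open Scope R_scope.

Definition irrational (x : R) : Prop := forall q : Q, x <> Q2R q.

Definition Cexp (z : C) : C := (exp (Re z) * (cos (Im z), sin (Im z)))%C.

Definition analytic_at (f : C -> C) (z0 : C) : Prop :=
  exists (c : nat -> C) (r : R), 0 < r /\
    forall z : C, Cmod (z - z0) < r ->
      @is_pseries C_AbsRing C_NormedModule c (z - z0)%C (f z).

(* [f] is a total function; its values outside the open disc are irrelevant. *)
Definition analytic_on_unit_disc (f : C -> C) : Prop :=
  forall z0 : C, Cmod z0 < 1 -> analytic_at f z0.

(* [Finite_sets.Finite], as opposed to Coquelicot's [Rbar.Finite]. *)
Definition infinite (A : nat -> Prop) : Prop := ~ Finite_sets.Finite nat A.

(* |A ∩ [0, n]|; membership in [A] is decided classically. *)
Definition count (A : nat -> Prop) (n : nat) : nat :=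
  length (filter (fun k => if excluded_middle_informative (A k) then true else false)
                 (seq 0 (S n))).

(* [ln] is 0 on nonpositive reals, which matters only for small [x]: for fixed
   [m] and [x] large every intermediate logarithm is positive. *)
Definition iter_log (m : nat) (x : R) : R := Nat.iter m ln x.

(* [is_domin F g h] says that [h = o(g)] along the filter [F]. *)
Definition very_sparse (A : nat -> Prop) : Prop :=
  forall m : nat, (1 <= m)%nat ->
    is_domin eventually (fun n => iter_log m (INR n)) (fun n => INR (count A n)).

(* Main.v *)
Require Import Defs.
From Stdlib Require Import Reals Factorial List ClassicalEpsilon Lra Lia.
From Coquelicot Require Import Coquelicot.
Open Scope R_scope.

(** Take [f z = z * exp (2 i pi h(z))] where [h z = z (1 + s z)] has real coefficients.
    At [z = (1 / 2) ^ n] the modulus is right, so [f (a1 ^ n) = a2 ^ n] says exactly that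
    [n * theta - h ((1 / 2) ^ n)] is an integer.  If [|s| <= 1/10] on [0, 1/2], such an [n]
    is a close return of the rotation by [theta]: [n * theta] exceeds some integer [p] by
    a quantity between [9/10] and [11/10] of [(1 / 2) ^ n] ([close_return]).

    Close returns are very sparse for every angle.  If [n < n'] are close returns with
    remainders [d] and [d'], then [n * d' - n' * d] is a negative integer, so
    [n' * d >= 1] and [n'] is at least about [2 ^ n] ([close_return_gap]).  Elements of
    the set thus grow like a tower of exponentials, and their number up to [n] is
    dominated by every iterated logarithm ([very_sparse_of_gaps]).  Infinitely many close
    returns also force [theta] to be irrational, since the remainders are positive and
    tend to 0 ([irrational_of_close_returns]).

    It remains to find [theta] and [s] with infinitely many coincidences.  The function
    [s] is a Newton series, the sum of the [b k * prod_(i < k) (z - x i)] with nodes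
    [x i = (1 / 2) ^ q i], so that [b k] is determined by the coincidence at [q k] without
    affecting the earlier ones.  An analytic function is determined by its values on
    [x], so the angle cannot be fixed beforehand: the nodes, the integers [p k] and an
    interval of possible angles are chosen in turn, the coefficients remaining
    continuous functions of the angle.  For [q k] large, the intermediate value theorem
    finds in the current interval an angle for which [b k] vanishes, and the interval is
    shrunk around it until [|b k| <= 1/20] ([refinement], [diophantine_interpolation]).

    Analyticity comes from [majorized], the algebra of power series around a given
    point with summable coefficients on a given disc.  It is closed under dominated
    series ([majorized_series]), hence under products and the exponential.  Bounded
    coefficients and nodes tending to 0 make the Newton series a dominated series on
    every closed disc inside the unit disc ([newton_series]). *)

(** * Series of complex numbers *)

Notation Cseries := (@is_series C_AbsRing C_NormedModule).
Definition Csum (a : nat -> C) (n : nat) : C := @sum_n C_NormedModule a n.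

(** [is_series] speaks of the product topology on [C]; estimates are made in [Cmod]. *)
Lemma Cseries_eps (a : nat -> C) (l : C) :
  Cseries a l <->
  forall eps : R, 0 < eps ->
    exists N, forall n, (N <= n)%nat -> Cmod (Csum a n - l)%C < eps.
Proof.
  split.
  - intros H eps Heps.
    assert (L : @locally_norm C_AbsRing C_NormedModule l
                  (fun z => Cmod (z - l)%C < eps)).
    { exists (mkposreal eps Heps). intros z Hz. exact Hz. }
    apply (locally_le_locally_norm l) in L.
    destruct (H _ L) as [N HN]. exists N. exact HN.
  - intros H P HP.
    apply (locally_norm_le_locally l) in HP.
    destruct HP as [e He].
    destruct (H e (cond_pos e)) as [N HN]. exists N.
    intros n Hn. apply He. exact (HN n Hn).
Qed.

Lemma Cseries_unique (a : nat -> C) (l1 l2 : C) :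
  Cseries a l1 -> Cseries a l2 -> l1 = l2.
Proof.
  intros H1 H2. exact (filterlim_locally_unique _ _ _ H1 H2).
Qed.

Lemma Cseries_ext (a b : nat -> C) (l : C) :
  (forall n, a n = b n) -> Cseries a l -> Cseries b l.
Proof. intros E. now apply is_series_ext. Qed.

Lemma Csum_S (a : nat -> C) n : Csum a (S n) = (Csum a n + a (S n))%C.
Proof. exact (sum_Sn a n). Qed.

Lemma Csum_0 (a : nat -> C) : Csum a 0%nat = a 0%nat.
Proof. exact (sum_O a). Qed.

Lemma Rsum_S (a : nat -> R) n : sum_n a (S n) = sum_n a n + a (S n).
Proof. exact (sum_Sn a n). Qed.

Lemma Rsum_0 (a : nat -> R) : sum_n a 0%nat = a 0%nat.
Proof. exact (sum_O a). Qed.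

Lemma Rsum_incr (a : nat -> R) (n m : nat) :
  (forall k, 0 <= a k) -> (n <= m)%nat -> sum_n a n <= sum_n a m.
Proof.
  intros Ha H. induction H as [|m H IH]; [lra|].
  rewrite Rsum_S. specialize (Ha (S m)). lra.
Qed.

Lemma Rsum_term_le (a : nat -> R) (n : nat) :
  (forall k, 0 <= a k) -> a n <= sum_n a n.
Proof.
  intros Ha. destruct n as [|n]; [rewrite Rsum_0; lra|].
  rewrite Rsum_S.
  assert (H := Rsum_incr a 0 n Ha (Nat.le_0_l _)). rewrite Rsum_0 in H.
  specialize (Ha 0%nat). lra.
Qed.

Lemma Cmod_Csum_sub (a : nat -> C) (M : nat -> R) (n m : nat) :
  (forall k, Cmod (a k) <= M k) -> (n <= m)%nat ->
  Cmod (Csum a m - Csum a n)%C <= sum_n M m - sum_n M n.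
Proof.
  intros Ha H. induction H as [|m H IH].
  - replace (Csum a n - Csum a n)%C with (RtoC 0) by ring. rewrite Cmod_0. lra.
  - rewrite Csum_S, Rsum_S.
    replace (Csum a m + a (S m) - Csum a n)%C
      with ((Csum a m - Csum a n) + a (S m))%C by ring.
    eapply Rle_trans; [apply Cmod_triangle|].
    specialize (Ha (S m)). lra.
Qed.

Lemma Cmod_Csum (a : nat -> C) (M : nat -> R) (n : nat) :
  (forall k, Cmod (a k) <= M k) -> Cmod (Csum a n) <= sum_n M n.
Proof.
  intros Ha. induction n as [|n IH].
  - rewrite Csum_0, Rsum_0. apply Ha.
  - rewrite Csum_S, Rsum_S.
    eapply Rle_trans; [apply Cmod_triangle|]. specialize (Ha (S n)). lra.
Qed.

(** Closed balls are closed: a bound on the tail of the partial sums passes to the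
    sum of the series. *)
Lemma Cseries_dist_le (a : nat -> C) (l z : C) (e : R) (N : nat) :
  Cseries a l -> (forall n, (N <= n)%nat -> Cmod (Csum a n - z)%C <= e) ->
  Cmod (l - z)%C <= e.
Proof.
  intros Hl H. apply Rle_plus_epsilon. intros eps Heps.
  destruct (proj1 (Cseries_eps a l) Hl eps Heps) as [K HK].
  specialize (HK (max N K) (Nat.le_max_r _ _)).
  specialize (H (max N K) (Nat.le_max_l _ _)).
  set (S := Csum a (max N K)) in *.
  replace (l - z)%C with ((S - z) + - (S - l))%C by ring.
  eapply Rle_trans; [apply Cmod_triangle|]. rewrite Cmod_opp. lra.
Qed.

Lemma Rsum_tail (M : nat -> R) (B : R) :
  (forall k, 0 <= M k) -> (forall n, sum_n M n <= B) ->
  forall eps, 0 < eps -> exists K, forall m, (K <= m)%nat ->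
    sum_n M m - sum_n M K <= eps.
Proof.
  intros HM HB eps Heps.
  destruct (ex_finite_lim_seq_incr (sum_n M) B) as [l Hl].
  - intros n. apply Rsum_incr; auto.
  - exact HB.
  - apply is_lim_seq_spec in Hl.
    destruct (Hl (mkposreal (eps / 2) ltac:(lra))) as [K HK]. simpl in HK.
    exists K. intros m Hm.
    assert (H1 := HK m Hm). assert (H2 := HK K (Nat.le_refl _)).
    apply Rabs_def2 in H1. apply Rabs_def2 in H2. lra.
Qed.

Lemma Cseries_dominated (a : nat -> C) (M : nat -> R) (B : R) :
  (forall k, Cmod (a k) <= M k) -> (forall n, sum_n M n <= B) ->
  exists l, Cseries a l.
Proof.
  intros Ha HB.
  assert (HM : forall k, 0 <= M k)
    by (intros k; specialize (Ha k); assert (H := Cmod_ge_0 (a k)); lra).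
  apply (ex_series_le (V := C_CompleteNormedModule) a M).
  - intros n. exact (Ha n).
  - destruct (ex_finite_lim_seq_incr (sum_n M) B) as [l Hl].
    + intros n. apply Rsum_incr; auto.
    + exact HB.
    + exists l. exact Hl.
Qed.

Lemma Cseries_finite_sum (a : nat -> nat -> C) (s : nat -> C) (N : nat) :
  (forall n, Cseries (a n) (s n)) ->
  Cseries (fun k => Csum (fun n => a n k) N) (Csum s N).
Proof.
  intros H. induction N as [|N IH].
  - rewrite Csum_0. eapply Cseries_ext; [|apply H].
    intros k. now rewrite Csum_0.
  - rewrite Csum_S. eapply Cseries_ext; [|exact (is_series_plus _ _ _ _ IH (H (S N)))].
    intros k. now rewrite Csum_S.
Qed.

Lemma Csum_tendsto (a : nat -> nat -> C) (b : nat -> C) (K : nat) :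
  (forall k eps, 0 < eps -> exists N, forall n, (N <= n)%nat ->
     Cmod (a n k - b k)%C < eps) ->
  forall eps, 0 < eps -> exists N, forall n, (N <= n)%nat ->
     Cmod (Csum (a n) K - Csum b K)%C < eps.
Proof.
  intros H. induction K as [|K IH]; intros eps Heps.
  - destruct (H 0%nat eps Heps) as [N HN]. exists N. intros n Hn.
    rewrite !Csum_0. now apply HN.
  - destruct (IH (eps / 2)) as [N1 H1]; [lra|].
    destruct (H (S K) (eps / 2)) as [N2 H2]; [lra|].
    exists (max N1 N2). intros n Hn.
    specialize (H1 n ltac:(lia)). specialize (H2 n ltac:(lia)).
    rewrite !Csum_S.
    replace (Csum (a n) K + a n (S K) - (Csum b K + b (S K)))%C
      with ((Csum (a n) K - Csum b K) + (a n (S K) - b (S K)))%C by ring.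
    eapply Rle_lt_trans; [apply Cmod_triangle|]. lra.
Qed.

(** Tannery's theorem, that is dominated convergence for series: cut the sum over [k]
    at a [K] beyond which the tail of [M] is small, uniformly in [n], and pass to the
    limit in the finitely many remaining terms. *)
Lemma tannery (a : nat -> nat -> C) (b s : nat -> C) (l : C) (M : nat -> R) (B : R) :
  (forall n k, Cmod (a n k) <= M k) -> (forall n, sum_n M n <= B) ->
  (forall k eps, 0 < eps -> exists N, forall n, (N <= n)%nat ->
     Cmod (a n k - b k)%C < eps) ->
  (forall n, Cseries (a n) (s n)) -> Cseries b l ->
  forall eps, 0 < eps -> exists N, forall n, (N <= n)%nat -> Cmod (s n - l)%C < eps.
Proof.
  intros Ha HB Hab Hs Hl eps Heps.
  assert (HM : forall k, 0 <= M k)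
    by (intros k; specialize (Ha 0%nat k); assert (H := Cmod_ge_0 (a 0%nat k)); lra).
  destruct (Rsum_tail M B HM HB (eps / 4)) as [K HK]; [lra|].
  assert (Tn : forall n, Cmod (s n - Csum (a n) K)%C <= eps / 4).
  { intros n. apply (Cseries_dist_le (a n) _ _ _ K (Hs n)). intros m Hm.
    eapply Rle_trans; [apply (Cmod_Csum_sub _ M); auto|]. now apply HK. }
  destruct (proj1 (Cseries_eps b l) Hl (eps / 4)) as [N1 H1]; [lra|].
  assert (Hb : forall k, Cmod (b k) <= M k).
  { intros k. apply Rle_plus_epsilon. intros e He.
    destruct (Hab k e He) as [N HN]. specialize (HN N (Nat.le_refl _)).
    replace (b k) with (a N k + - (a N k - b k))%C by ring.
    eapply Rle_trans; [apply Cmod_triangle|]. rewrite Cmod_opp.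
    specialize (Ha N k). lra. }
  assert (Tl : Cmod (l - Csum b K)%C <= eps / 4).
  { apply (Cseries_dist_le b _ _ _ K Hl). intros m Hm.
    eapply Rle_trans; [apply (Cmod_Csum_sub _ M); auto|]. now apply HK. }
  destruct (Csum_tendsto a b K Hab (eps / 4)) as [N HN]; [lra|].
  exists N. intros n Hn. specialize (HN n Hn). specialize (Tn n).
  replace (s n - l)%C with
    ((s n - Csum (a n) K) + ((Csum (a n) K - Csum b K) + - (l - Csum b K)))%C by ring.
  eapply Rle_lt_trans; [apply Cmod_triangle|].
  eapply Rle_lt_trans; [apply Rplus_le_compat_l, Cmod_triangle|].
  rewrite Cmod_opp. lra.
Qed.

(** * Functions majorized by a power series *)

(** [F] is the sum of a power series around [z0] whose coefficients have weighted
    [l1]-norm at most [M] on the disc of radius [r].  These functions form a Banach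
    algebra, which is what makes products, infinite sums and exponentials of analytic
    functions analytic without any complex integration.  Bounding the partial sums
    says at once that the series of norms converges and that its sum is at most [M]. *)
Definition majorized (z0 : C) (r M : R) (F : C -> C) : Prop :=
  exists c : nat -> C,
    (forall N, sum_n (fun n => Cmod (c n) * r ^ n) N <= M) /\
    (forall w : C, Cmod w <= r -> Cseries (fun n => c n * w ^ n)%C (F (z0 + w)%C)).

Lemma Cpow_S (w : C) n : (w ^ S n = w * w ^ n)%C.
Proof. reflexivity. Qed.

Lemma pow_n_Cpow (w : C) n : @pow_n C_AbsRing w n = (w ^ n)%C.
Proof. induction n as [|n IH]; simpl; [reflexivity|now rewrite IH]. Qed.

Lemma analytic_of_majorized (F : C -> C) (z0 : C) (r M : R) :
  0 < r -> majorized z0 r M F -> analytic_at F z0.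
Proof.
  intros Hr [c [_ Hc]]. exists c, r. split; [exact Hr|].
  intros z Hz. specialize (Hc (z - z0)%C (Rlt_le _ _ Hz)).
  replace (z0 + (z - z0))%C with z in Hc by ring.
  unfold is_pseries. eapply Cseries_ext; [|exact Hc].
  intros n. rewrite pow_n_Cpow. apply Cmult_comm.
Qed.

Section Algebra.
Variables (z0 : C) (r : R).
Hypothesis Hr : 0 < r.

Lemma coef_term_nonneg (c : nat -> C) n : 0 <= Cmod (c n) * r ^ n.
Proof. apply Rmult_le_pos; [apply Cmod_ge_0|apply pow_le; lra]. Qed.

Lemma term_le (c : nat -> C) (w : C) n :
  Cmod w <= r -> Cmod (c n * w ^ n)%C <= Cmod (c n) * r ^ n.
Proof.
  intros Hw. rewrite Cmod_mult, Cmod_pow.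
  apply Rmult_le_compat_l; [apply Cmod_ge_0|].
  apply pow_incr. split; [apply Cmod_ge_0|exact Hw].
Qed.

Lemma majorized_nonneg F M : majorized z0 r M F -> 0 <= M.
Proof.
  intros [c [H _]]. specialize (H 0%nat). rewrite Rsum_0 in H.
  assert (H1 := coef_term_nonneg c 0). lra.
Qed.

Lemma majorized_ext F G M :
  (forall w, Cmod w <= r -> F (z0 + w)%C = G (z0 + w)%C) ->
  majorized z0 r M F -> majorized z0 r M G.
Proof.
  intros E [c [H1 H2]]. exists c. split; [exact H1|].
  intros w Hw. rewrite <- E by exact Hw. auto.
Qed.

Lemma majorized_weaken F M M' : M <= M' -> majorized z0 r M F -> majorized z0 r M' F.
Proof.
  intros H [c [H1 H2]]. exists c. split; [|exact H2].
  intros N. specialize (H1 N). lra.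
Qed.

Lemma majorized_bound F M w : majorized z0 r M F -> Cmod w <= r -> Cmod (F (z0 + w)%C) <= M.
Proof.
  intros [c [H1 H2]] Hw. specialize (H2 w Hw).
  replace (F (z0 + w)%C) with (F (z0 + w) - 0)%C by ring.
  apply (Cseries_dist_le _ _ _ _ 0 H2). intros n _.
  unfold Cminus. rewrite Copp_0, Cplus_0_r.
  eapply Rle_trans; [|apply (H1 n)].
  apply Cmod_Csum. intros k. now apply term_le.
Qed.

Lemma majorized_scal F M k :
  majorized z0 r M F -> majorized z0 r (Cmod k * M) (fun z => k * F z)%C.
Proof.
  intros [c [H1 H2]]. exists (fun n => k * c n)%C. split.
  - intros N. rewrite (sum_n_ext _ (fun n => Cmod k * (Cmod (c n) * r ^ n))).
    + rewrite (sum_n_mult_l (K := R_AbsRing) (Cmod k)).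
      apply Rmult_le_compat_l; [apply Cmod_ge_0|apply H1].
    + intros n. rewrite Cmod_mult. exact (Rmult_assoc _ _ _).
  - intros w Hw. specialize (H2 w Hw).
    apply (is_series_scal k) in H2. eapply Cseries_ext; [|exact H2].
    intros n. change (k * (c n * w ^ n) = k * c n * w ^ n)%C. ring.
Qed.

Lemma majorized_shift F M :
  majorized z0 r M F -> majorized z0 r (r * M) (fun z => (z - z0) * F z)%C.
Proof.
  intros [c [H1 H2]].
  exists (fun n => match n with 0%nat => RtoC 0 | S n => c n end). split.
  - assert (E : forall N, sum_n (fun n => Cmod (match n with 0%nat => RtoC 0 | S n => c n end) * r ^ n) (S N)
       = r * sum_n (fun n => Cmod (c n) * r ^ n) N).
    { induction N as [|N IH].
      - rewrite Rsum_S, !Rsum_0. rewrite Cmod_0. simpl. ring.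
      - rewrite Rsum_S, IH, Rsum_S. simpl. ring. }
    intros [|N].
    + rewrite Rsum_0, Cmod_0.
      assert (0 <= M) by (apply (majorized_nonneg F); exists c; auto). simpl. nra.
    + rewrite E. apply Rmult_le_compat_l; [lra|apply H1].
  - intros w Hw. specialize (H2 w Hw).
    replace (z0 + w - z0)%C with w by ring.
    apply (is_series_decr_n _ 1); [lia|].
    replace (sum_n _ (Nat.pred 1)) with (RtoC 0).
    2:{ simpl. rewrite sum_O. now rewrite Cmult_0_l. }
    apply (is_series_scal w) in H2.
    replace (plus _ (opp (RtoC 0))) with (w * F (z0 + w))%C.
    2:{ change (w * F (z0 + w) = w * F (z0 + w) + - RtoC 0)%C. ring. }
    eapply Cseries_ext; [|exact H2].
    intros n. change (w * (c n * w ^ n) = c n * (w * w ^ n))%C. ring.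
Qed.

Lemma majorized_const k : majorized z0 r (Cmod k) (fun _ => k).
Proof.
  exists (fun n => match n with 0%nat => k | S _ => RtoC 0 end).
  assert (E : forall w N, Csum (fun n => (match n with 0%nat => k | S _ => RtoC 0 end) * w ^ n)%C N = k).
  { intros w. induction N as [|N IH].
    - rewrite Csum_0. simpl. ring.
    - rewrite Csum_S, IH. ring. }
  split.
  - induction N as [|N IH].
    + rewrite Rsum_0. simpl. lra.
    + rewrite Rsum_S, Cmod_0. lra.
  - intros w _. apply Cseries_eps. intros eps Heps. exists 0%nat. intros n _.
    rewrite E. replace (k - k)%C with (RtoC 0) by ring. now rewrite Cmod_0.
Qed.

(** Completeness of the algebra, from which closure under products and exponentials
    follows.  The coefficient of order [n] of the sum is the sum over [k] of the
    coefficients [c k n] of the terms, and the double series [c k n * w ^ n] may be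
    summed in either order because it is dominated by [M k].  The auxiliary [d n] is
    the coefficient scaled by [r ^ n], the form in which [M] bounds the terms. *)
Lemma majorized_series (F : nat -> C -> C) (G : C -> C) (M : nat -> R) (B : R) :
  (forall k, majorized z0 r (M k) (F k)) ->
  (forall n, sum_n M n <= B) ->
  (forall w, Cmod w <= r -> Cseries (fun k => F k (z0 + w)%C) (G (z0 + w)%C)) ->
  majorized z0 r B G.
Proof.
  intros HF HB HG.
  destruct (choice _ HF) as [c Hc].
  assert (Hpos : forall n, 0 < r ^ n) by (intros n; apply pow_lt, Hr).
  assert (Hterm : forall k n, Cmod (c k n) * r ^ n <= M k).
  { intros k n. eapply Rle_trans; [|apply (proj1 (Hc k) n)].
    apply (Rsum_term_le (fun n => Cmod (c k n) * r ^ n)). intros. apply coef_term_nonneg. }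
  assert (Hd : forall n, exists d, Cseries (fun k => c k n * RtoC (r ^ n))%C d).
  { intros n. apply (Cseries_dominated _ M B); [|exact HB].
    intros k. rewrite Cmod_mult, Cmod_R, Rabs_pos_eq by (apply Rlt_le, Hpos). apply Hterm. }
  destruct (choice _ Hd) as [d Hd'].
  exists (fun n => d n / RtoC (r ^ n))%C. split.
  - intros N.
    apply (Rle_trans _ (sum_n (fun n => Cmod (d n)) N)).
    { apply Req_le, sum_n_ext. intros n.
      assert (Hn : RtoC (r ^ n) <> 0).
      { intros E. apply RtoC_inj in E. specialize (Hpos n). lra. }
      rewrite Cmod_div, Cmod_R, Rabs_pos_eq by (auto; apply Rlt_le, Hpos).
      match goal with |- ?x = ?y => change (@eq R x y) end.
      field. specialize (Hpos n). lra. }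
    apply Rle_plus_epsilon. intros eps Heps.
    (* The norms of finitely many [d n] are approached by those of partial sums,
       for which the two sums can be exchanged. *)
    assert (T : forall N e, 0 < e -> exists K0, forall K, (K0 <= K)%nat ->
       sum_n (fun n => Cmod (d n)) N <=
       sum_n (fun n => Cmod (Csum (fun k => c k n * RtoC (r ^ n))%C K)) N + e).
    { clear - Hd'. induction N as [|N IH]; intros e He.
      - destruct (proj1 (Cseries_eps _ _) (Hd' 0%nat) e He) as [K0 HK0].
        exists K0. intros K HK. specialize (HK0 K HK). rewrite !Rsum_0.
        set (S := Csum _ K) in *.
        replace (d 0%nat) with (S + - (S - d 0%nat))%C by ring.
        eapply Rle_trans; [apply Cmod_triangle|]. rewrite Cmod_opp. lra.
      - destruct (proj1 (Cseries_eps _ _) (Hd' (S N)) (e / 2)) as [K0 HK0]; [lra|].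
        destruct (IH (e / 2)) as [K1 HK1]; [lra|].
        exists (max K0 K1). intros K HK. specialize (HK0 K ltac:(lia)).
        specialize (HK1 K ltac:(lia)). rewrite !Rsum_S.
        set (S := Csum (fun k => c k (Datatypes.S N) * _)%C K) in *.
        assert (Cmod (d (Datatypes.S N)) <= Cmod S + e / 2); [|lra].
        replace (d (Datatypes.S N)) with (S + - (S - d (Datatypes.S N)))%C by ring.
        eapply Rle_trans; [apply Cmod_triangle|]. rewrite Cmod_opp. lra. }
    destruct (T N eps Heps) as [K HK]. specialize (HK K (Nat.le_refl _)).
    assert (sum_n (fun n => Cmod (Csum (fun k => c k n * RtoC (r ^ n))%C K)) N <= B); [|lra].
    apply (Rle_trans _ (sum_n (fun n => sum_n (fun k => Cmod (c k n) * r ^ n) K) N)).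
    { apply sum_n_m_le. intros n. apply Cmod_Csum. intros k.
      rewrite Cmod_mult, Cmod_R, Rabs_pos_eq by (apply Rlt_le, Hpos). lra. }
    rewrite sum_n_switch.
    eapply Rle_trans; [|apply (HB K)].
    apply sum_n_m_le. intros k. apply (proj1 (Hc k)).
  - intros w Hw. apply Cseries_eps.
    assert (HsF : forall k, Cseries (fun n => c k n * w ^ n)%C (F k (z0 + w)%C))
      by (intros k; apply (proj2 (Hc k) w Hw)).
    apply (tannery (fun n k => Csum (fun j => c k j * w ^ j)%C n)
             (fun k => F k (z0 + w)%C) _ (G (z0 + w)%C) M B).
    + intros n k. eapply Rle_trans; [|apply (proj1 (Hc k) n)].
      apply Cmod_Csum. intros j. now apply term_le.
    + exact HB.
    + intros k. apply Cseries_eps, HsF.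
    + intros N. apply (Cseries_finite_sum (fun n k => c k n * w ^ n)%C
                         (fun n => d n / RtoC (r ^ n) * w ^ n)%C).
      intros n. assert (Hn : RtoC (r ^ n) <> 0).
      { intros E. apply RtoC_inj in E. specialize (Hpos n). lra. }
      assert (H := is_series_scal (w ^ n / RtoC (r ^ n))%C _ _ (Hd' n)).
      replace (d n / RtoC (r ^ n) * w ^ n)%C
        with (w ^ n / RtoC (r ^ n) * d n)%C by (field; exact Hn).
      eapply Cseries_ext; [|exact H]. intros k.
      change (w ^ n / RtoC (r ^ n) * (c k n * RtoC (r ^ n)) = c k n * w ^ n)%C.
      field. exact Hn.
    + apply HG, Hw.
Qed.

Lemma majorized_monomial_mult F M i :
  majorized z0 r M F -> majorized z0 r (r ^ i * M) (fun z => (z - z0) ^ i * F z)%C.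
Proof.
  intros HF. induction i as [|i IH].
  - simpl. apply (majorized_ext F); [intros; ring|]. now rewrite Rmult_1_l.
  - apply majorized_shift in IH. simpl. rewrite Rmult_assoc.
    eapply majorized_ext; [|exact IH]. intros w _. simpl. ring.
Qed.

(** Expanding only the first factor turns the product into the series of the functions
    [c i * (z - z0) ^ i * G z], so no Cauchy product is needed. *)
Lemma majorized_mult F G M N :
  majorized z0 r M F -> majorized z0 r N G ->
  majorized z0 r (M * N) (fun z => F z * G z)%C.
Proof.
  intros [c [H1 H2]] HG.
  apply (majorized_series (fun i z => c i * ((z - z0) ^ i * G z))%C _
           (fun i => (Cmod (c i) * r ^ i) * N)).
  - intros i. rewrite Rmult_assoc. apply majorized_scal, majorized_monomial_mult, HG.
  - intros n. rewrite (sum_n_mult_r (K := R_AbsRing) N).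
    apply Rmult_le_compat_r; [now apply (majorized_nonneg G)|apply H1].
  - intros w Hw. specialize (H2 w Hw).
    apply (is_series_scal (G (z0 + w)%C)) in H2. rewrite Cmult_comm.
    eapply Cseries_ext; [|exact H2]. intros i.
    change (G (z0 + w) * (c i * w ^ i) = c i * ((z0 + w - z0) ^ i * G (z0 + w)))%C.
    replace (z0 + w - z0)%C with w by ring. ring.
Qed.

Lemma majorized_plus F G M N :
  majorized z0 r M F -> majorized z0 r N G ->
  majorized z0 r (M + N) (fun z => F z + G z)%C.
Proof.
  intros [c [H1 H2]] [d [H3 H4]]. exists (fun n => c n + d n)%C. split.
  - intros n. eapply Rle_trans; [|apply Rplus_le_compat; [apply (H1 n)|apply (H3 n)]].
    rewrite <- (sum_n_plus (G := R_AbelianMonoid)). apply sum_n_m_le. intros k.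
    change (Cmod (c k + d k) * r ^ k <= Cmod (c k) * r ^ k + Cmod (d k) * r ^ k).
    rewrite <- Rmult_plus_distr_r. apply Rmult_le_compat_r; [apply pow_le; lra|].
    apply Cmod_triangle.
  - intros w Hw.
    eapply Cseries_ext; [|exact (is_series_plus _ _ _ _ (H2 w Hw) (H4 w Hw))].
    intros n. change (c n * w ^ n + d n * w ^ n = (c n + d n) * w ^ n)%C. ring.
Qed.

Lemma majorized_id : majorized z0 r (Cmod z0 + r) (fun z => z).
Proof.
  assert (H := majorized_shift _ _ (majorized_const (RtoC 1))).
  rewrite Cmod_1, Rmult_1_r in H.
  eapply majorized_ext; [|exact (majorized_plus _ _ _ _ (majorized_const z0) H)].
  intros w _. simpl. ring.
Qed.

Lemma majorized_pow F M m : majorized z0 r M F -> majorized z0 r (M ^ m) (fun z => F z ^ m)%C.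
Proof.
  intros HF. induction m as [|m IH].
  - simpl. assert (H := majorized_const (RtoC 1)). rewrite Cmod_1 in H. exact H.
  - simpl. now apply majorized_mult.
Qed.

Lemma exp_partial_le x n : 0 <= x -> sum_n (fun m => x ^ m / INR (fact m)) n <= exp x.
Proof.
  intros Hx. assert (H := is_exp_Reals x). unfold is_pseries in H.
  apply (is_lim_seq_incr_compare (sum_n (fun m => x ^ m / INR (fact m)))).
  - change (is_series (fun m => x ^ m / INR (fact m)) (exp x)).
    refine (is_series_ext _ _ _ _ H). intros m.
    change (pow_n x m * / INR (fact m) = x ^ m / INR (fact m)).
    rewrite pow_n_pow. reflexivity.
  - intros k. apply Rsum_incr; [|lia]. intros m.
    apply Rmult_le_pos; [now apply pow_le|]. apply Rlt_le, Rinv_0_lt_compat, INR_fact_lt_0.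
Qed.

(** The term of order [m] of the exponential series has norm at most [M ^ m / m!]. *)
Lemma majorized_exp (E F : C -> C) M :
  (forall z, Cseries (fun m => z ^ m / RtoC (INR (fact m)))%C (E z)) ->
  majorized z0 r M F -> majorized z0 r (exp M) (fun z => E (F z)).
Proof.
  intros HE HF.
  apply (majorized_series (fun m z => / RtoC (INR (fact m)) * F z ^ m)%C _
           (fun m => M ^ m / INR (fact m))).
  - intros m. assert (H := INR_fact_lt_0 m).
    assert (Hm := majorized_scal _ _ (/ RtoC (INR (fact m)))%C (majorized_pow _ _ m HF)).
    rewrite Cmod_inv, Cmod_R, Rabs_pos_eq in Hm.
    + unfold Rdiv. rewrite Rmult_comm. exact Hm.
    + lra.
    + intros E0. apply RtoC_inj in E0. lra.
  - intros n. apply exp_partial_le. now apply (majorized_nonneg F).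
  - intros w Hw. eapply Cseries_ext; [|apply HE]. intros m. apply Cmult_comm.
Qed.

End Algebra.

(** * The complex exponential *)

Lemma Cmod_pair_le (a b : R) : Cmod (a, b) <= Rabs a + Rabs b.
Proof.
  replace ((a, b) : C) with (RtoC a + Ci * RtoC b)%C.
  - eapply Rle_trans; [apply Cmod_triangle|].
    rewrite Cmod_mult, Cmod_Ci, !Cmod_R. lra.
  - unfold RtoC, Ci, Cmult, Cplus. simpl. f_equal; ring.
Qed.

(** The even terms of the series at [i y] are real and make up the cosine, the odd ones
    are imaginary and make up the sine. *)
Lemma exp_series_imaginary (y : R) (N : nat) :
  Csum (fun m => (Ci * RtoC y) ^ m / RtoC (INR (fact m)))%C (2 * N + 1) =
  (sum_f_R0 (fun j => cos_n j * (y²) ^ j) N,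
   y * sum_f_R0 (fun j => sin_n j * (y²) ^ j) N).
Proof.
  assert (P : forall j, ((Ci * RtoC y) ^ (2 * j))%C = RtoC ((-1) ^ j * (y²) ^ j)).
  { induction j as [|j IH].
    - simpl. now rewrite Rmult_1_l.
    - replace (2 * S j)%nat with (S (S (2 * j))) by lia.
      rewrite !Cpow_S, IH. unfold RtoC, Ci, Cmult, Rsqr. simpl. f_equal; ring. }
  assert (T0 : forall j, ((Ci * RtoC y) ^ (2 * j) / RtoC (INR (fact (2 * j))))%C =
                (cos_n j * (y²) ^ j, 0)).
  { intros j. rewrite P. rewrite <- RtoC_div by apply INR_fact_neq_0. unfold RtoC, cos_n. f_equal.
    field. apply INR_fact_neq_0. }
  assert (T1 : forall j, ((Ci * RtoC y) ^ (S (2 * j)) / RtoC (INR (fact (S (2 * j)))))%C =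
                (0, y * (sin_n j * (y²) ^ j))).
  { intros j. rewrite Cpow_S, P.
    assert (Hf := INR_fact_neq_0 (S (2 * j))).
    replace (Ci * RtoC y * RtoC ((-1) ^ j * y² ^ j) / RtoC (INR (fact (S (2 * j)))))%C
      with (Ci * RtoC (y * ((-1) ^ j / INR (fact (S (2 * j))) * y² ^ j)))%C.
    - unfold sin_n. replace (2 * j + 1)%nat with (S (2 * j)) by lia.
      unfold Ci, RtoC, Cmult. simpl. f_equal; ring.
    - rewrite !RtoC_mult, RtoC_div by exact Hf. field.
      intros H. apply RtoC_inj in H. auto. }
  induction N as [|N IH].
  - assert (A0 := T0 0%nat). assert (A1 := T1 0%nat).
    change (2 * 0)%nat with 0%nat in A0, A1 |- *. change (0 + 1)%nat with 1%nat.
    rewrite Csum_S, Csum_0, A0, A1. simpl. unfold Cplus. simpl. f_equal; ring.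
  - replace (2 * S N + 1)%nat with (S (S (2 * N + 1))) by lia.
    rewrite Csum_S, Csum_S, IH.
    replace (S (2 * N + 1)) with (2 * S N)%nat by lia.
    rewrite T0, T1. simpl sum_f_R0. unfold Cplus. simpl fst. simpl snd. f_equal; ring.
Qed.

(** Both series converge, so it is enough to compare them along the partial sums of
    odd index computed above. *)
Lemma complex_exponential :
  exists E : C -> C,
    (forall z, Cseries (fun m => z ^ m / RtoC (INR (fact m)))%C (E z)) /\
    (forall y : R, E (Ci * RtoC y)%C = (cos y, sin y)).
Proof.
  assert (Hex : forall z, exists l : C, Cseries (fun m => z ^ m / RtoC (INR (fact m)))%C l).
  { intros z.
    apply (Cseries_dominated _ (fun m => Cmod z ^ m / INR (fact m)) (exp (Cmod z))).
    - intros m. assert (Hf := INR_fact_lt_0 m).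
      rewrite Cmod_div, Cmod_pow, Cmod_R, Rabs_pos_eq; [lra|lra|].
      intros H. apply RtoC_inj in H. lra.
    - intros n. apply exp_partial_le, Cmod_ge_0. }
  destruct (choice _ Hex) as [E HE]. exists E. split; [exact HE|].
  intros y.
  assert (Hc : cos_in (y²) (cos y)) by (unfold cos; destruct (exist_cos y²) as [l Hl]; exact Hl).
  assert (Hs : exists l, sin_in (y²) l /\ sin y = y * l).
  { unfold sin. destruct (exist_sin y²) as [l Hl]. exists l. split; [exact Hl|reflexivity]. }
  destruct Hs as [l [Hl Hy]]. rewrite Hy. clear Hy.
  assert (Z : Cmod (E (Ci * RtoC y) - (cos y, (y * l)%R))%C <= 0).
  { apply Rle_plus_epsilon. intros eps Heps.
    set (e := eps / (2 + Rabs y)).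
    assert (Hy := Rabs_pos y).
    assert (He : 0 < e) by (apply Rdiv_lt_0_compat; lra).
    destruct (proj1 (Cseries_eps _ _) (HE (Ci * RtoC y)%C) e He) as [N0 H0].
    destruct (Hc e He) as [N1 H1]. destruct (Hl e He) as [N2 H2].
    set (N := max N0 (max N1 N2)).
    specialize (H0 (2 * N + 1)%nat ltac:(lia)). specialize (H1 N ltac:(lia)).
    specialize (H2 N ltac:(lia)). rewrite exp_series_imaginary in H0.
    unfold Rdist in H1, H2.
    set (c := sum_f_R0 _ N) in H1. set (s := sum_f_R0 _ N) in H2.
    fold c in H0. fold s in H0.
    replace (E (Ci * RtoC y) - (cos y, (y * l)%R))%C
      with (- ((c, (y * s)%R) - E (Ci * RtoC y)) + ((c - cos y)%R, (y * (s - l))%R))%C.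
    2:{ apply injective_projections; simpl; ring. }
    eapply Rle_trans; [apply Cmod_triangle|]. rewrite Cmod_opp.
    eapply Rle_trans; [apply Rplus_le_compat_l, Cmod_pair_le|].
    rewrite Rabs_mult.
    assert (Rabs y * Rabs (s - l) <= Rabs y * e) by (apply Rmult_le_compat_l; lra).
    assert (eps = 2 * e + Rabs y * e) by (unfold e; field; lra). lra. }
  assert (Z0 : Cmod (E (Ci * RtoC y) - (cos y, (y * l)%R))%C = 0)
    by (apply Rle_antisym; [exact Z|apply Cmod_ge_0]).
  apply Cmod_eq_0 in Z0.
  replace (E (Ci * RtoC y)%C) with (E (Ci * RtoC y) - (cos y, (y * l)%R) + (cos y, (y * l)%R))%C.
  - rewrite Z0. apply Cplus_0_l.
  - unfold Cminus. rewrite <- Cplus_assoc, (Cplus_comm (- _)), Cplus_opp_r. apply Cplus_0_r.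
Qed.

(** * Newton series *)

Lemma half_pow_pos n : 0 < (1 / 2) ^ n.
Proof. apply pow_lt. lra. Qed.

Lemma half_pow_decr n m : (n < m)%nat -> (1 / 2) ^ m <= (1 / 2) ^ n / 2.
Proof.
  intros H. induction H as [|m H IH]; simpl; [lra|].
  assert (Hm := half_pow_pos m). lra.
Qed.

Lemma half_pow_le n : (1 <= n)%nat -> (1 / 2) ^ n <= 1 / 2.
Proof. intros H. assert (K := half_pow_decr 0 n H). simpl in K. lra. Qed.

Fixpoint nodal (x : nat -> R) (k : nat) (t : R) : R :=
  match k with 0%nat => 1 | S k => (t - x k) * nodal x k t end.

Fixpoint Cnodal (x : nat -> R) (k : nat) (z : C) : C :=
  match k with 0%nat => RtoC 1 | S k => ((z - RtoC (x k)) * Cnodal x k z)%C end.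

Lemma Cnodal_RtoC x k t : Cnodal x k (RtoC t) = RtoC (nodal x k t).
Proof.
  induction k as [|k IH]; [reflexivity|]. simpl. now rewrite IH, RtoC_mult, RtoC_minus.
Qed.

Section Newton.
Variables (x b : nat -> R).
Hypothesis Hx : forall i, 0 < x i.
Hypothesis Hx0 : is_lim_seq x 0.
Hypothesis Hb : forall k, Rabs (b k) <= 1.

(** The product of the [rho + x i], which dominates the nodal polynomial on the disc of
    radius [rho] around 0, is a nodal polynomial with opposite nodes. *)
Let bound (k : nat) (rho : R) := nodal (fun i => - x i) k rho.

Lemma nodal_bound_pos k rho : 0 <= rho -> 0 < bound k rho.
Proof.
  intros H. unfold bound. induction k as [|k IH]; simpl; [lra|].
  apply Rmult_lt_0_compat; [|exact IH]. specialize (Hx k). lra.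
Qed.

(** The ratio of consecutive terms is [rho + x n], which tends to [rho] since the nodes
    tend to 0: this is why the Newton series converges in the whole unit disc. *)
Lemma nodal_bound_summable rho :
  0 <= rho < 1 -> exists B, forall n, sum_n (fun k => bound k rho) n <= B.
Proof.
  intros Hrho.
  assert (Hp := fun k => nodal_bound_pos k rho (proj1 Hrho)).
  destruct (ex_series_DAlembert (fun k => bound k rho) rho) as [B HB].
  - apply Hrho.
  - intros n. specialize (Hp n). lra.
  - apply (is_lim_seq_ext (fun n => rho + x n)).
    + intros n. specialize (Hx n). specialize (Hp n).
      unfold bound in *. simpl. set (a := nodal _ n rho) in *.
      replace ((rho - - x n) * a / a) with (rho + x n) by (field; lra).
      rewrite Rabs_pos_eq; lra.
    + replace (Finite rho) with (Finite (rho + 0)) by (f_equal; ring).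
      apply is_lim_seq_plus'; [apply is_lim_seq_const|exact Hx0].
  - exists B. intros n.
    apply (is_lim_seq_incr_compare (sum_n (fun k => bound k rho))).
    + change (is_series (fun k => bound k rho) B).
      refine (is_series_ext _ _ _ _ HB). intros k. apply Rabs_pos_eq, Rlt_le, Hp.
    + intros k. apply Rsum_incr; [|lia]. intros; apply Rlt_le, Hp.
Qed.

Lemma majorized_Cnodal z0 r k :
  0 < r -> majorized z0 r (bound k (Cmod z0 + r)) (Cnodal x k).
Proof.
  intros Hr. unfold bound. induction k as [|k IH]; simpl.
  - assert (H := majorized_const z0 r (RtoC 1)). rewrite Cmod_1 in H. exact H.
  - apply majorized_mult; [exact Hr| |exact IH].
    replace (Cmod z0 + r - - x k) with (Cmod z0 + r + Cmod (RtoC (- x k))).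
    + eapply majorized_ext.
      2:{ apply majorized_plus; [exact Hr|now apply majorized_id|now apply majorized_const]. }
      intros w _. simpl. rewrite RtoC_opp. ring.
    + rewrite Cmod_R, Rabs_Ropp, Rabs_pos_eq by (apply Rlt_le, Hx). ring.
Qed.

Lemma newton_term_majorized z0 r k :
  0 < r -> majorized z0 r (bound k (Cmod z0 + r)) (fun z => RtoC (b k) * Cnodal x k z)%C.
Proof.
  intros Hr. apply (majorized_weaken _ _ _ (Cmod (RtoC (b k)) * bound k (Cmod z0 + r))).
  - rewrite Cmod_R.
    assert (H : 0 < bound k (Cmod z0 + r))
      by (apply nodal_bound_pos; assert (H := Cmod_ge_0 z0); lra).
    specialize (Hb k). nra.
  - apply majorized_scal. now apply majorized_Cnodal.
Qed.

Lemma newton_series :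
  exists s : C -> C,
    (forall z, Cmod z < 1 -> Cseries (fun k => RtoC (b k) * Cnodal x k z)%C (s z)) /\
    (forall z0, Cmod z0 < 1 -> exists M, majorized z0 ((1 - Cmod z0) / 2) M s).
Proof.
  assert (Hex : forall z, exists l : C, Cmod z < 1 ->
     Cseries (fun k => RtoC (b k) * Cnodal x k z)%C l).
  { intros z. destruct (Rlt_dec (Cmod z) 1) as [Hz|Hz].
    2:{ exists (RtoC 0). intros; contradiction. }
    assert (H0 := Cmod_ge_0 z). set (r := (1 - Cmod z) / 2).
    assert (Hr : 0 < r) by (unfold r; lra).
    destruct (nodal_bound_summable (Cmod z + r)) as [B HB]; [unfold r in *; lra|].
    destruct (Cseries_dominated (fun k => RtoC (b k) * Cnodal x k z)%C
      (fun k => bound k (Cmod z + r)) B) as [l Hl]; [|exact HB|].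
    - intros k. assert (H := majorized_bound z r _ _ (RtoC 0) (newton_term_majorized z r k Hr)).
      simpl in H. rewrite Cplus_0_r in H. apply H. rewrite Cmod_0. lra.
    - exists l. auto. }
  destruct (choice _ Hex) as [s Hs]. exists s. split; [exact Hs|].
  intros z0 Hz0. assert (H0 := Cmod_ge_0 z0).
  assert (Hr : 0 < (1 - Cmod z0) / 2) by lra.
  destruct (nodal_bound_summable (Cmod z0 + (1 - Cmod z0) / 2)) as [B HB]; [lra|].
  exists B.
  eapply (majorized_series z0 _ Hr (fun k z => RtoC (b k) * Cnodal x k z)%C s).
  - intros k. apply newton_term_majorized, Hr.
  - exact HB.
  - intros w Hw. apply Hs. eapply Rle_lt_trans; [apply Cmod_triangle|]. lra.
Qed.

(** The function is [z * exp (2 i pi z (1 + s z))]; at real points where [s]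
    is real, the exponential factor lies on the unit circle. *)
Lemma newton_exponential :
  exists (s f : C -> C),
    (forall z, Cmod z < 1 -> Cseries (fun k => RtoC (b k) * Cnodal x k z)%C (s z)) /\
    analytic_on_unit_disc f /\
    (forall t u : R, s (RtoC t) = RtoC u ->
       f (RtoC t) = (RtoC t * (cos (2 * PI * (t * (1 + u))), sin (2 * PI * (t * (1 + u)))))%C).
Proof.
  destruct newton_series as [s [Hs HM]]. destruct complex_exponential as [E [HE Ey]].
  exists s, (fun z => z * E (Ci * RtoC (2 * PI) * (z * (1 + s z))))%C.
  split; [exact Hs|]. split.
  - intros z0 Hz0. destruct (HM z0 Hz0) as [M HMs].
    set (r := (1 - Cmod z0) / 2) in *. assert (Hr : 0 < r) by (unfold r; lra).
    eapply (analytic_of_majorized _ z0 r); [exact Hr|].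
    apply majorized_mult; [exact Hr|now apply majorized_id|].
    apply majorized_exp; [exact Hr|exact HE|].
    apply majorized_scal.
    apply majorized_mult; [exact Hr|now apply majorized_id|].
    apply majorized_plus; [exact Hr|now apply majorized_const|exact HMs].
  - intros t u Hu. cbv beta. rewrite Hu. rewrite <- Ey. do 2 f_equal.
    rewrite !RtoC_mult, RtoC_plus. ring.
Qed.
End Newton.

Section RealPoints.
Variables (x b : nat -> R).
Hypothesis Hx : forall i, 0 < x i <= 1 / 2.
Hypothesis Hb : forall k, Rabs (b k) <= 1 / 20.

Lemma newton_partial_sum t n :
  Csum (fun k => RtoC (b k) * Cnodal x k (RtoC t))%C n
  = RtoC (sum_n (fun k => b k * nodal x k t) n).
Proof.
  induction n as [|n IH].
  - rewrite Csum_0, Rsum_0, Cnodal_RtoC, RtoC_mult. reflexivity.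
  - rewrite Csum_S, Rsum_S, IH, Cnodal_RtoC, RtoC_plus, RtoC_mult. reflexivity.
Qed.

Lemma nodal_bound k t : 0 <= t <= 1 / 2 -> Rabs (nodal x k t) <= (1 / 2) ^ k.
Proof.
  intros Ht. induction k as [|k IH]; simpl; [rewrite Rabs_R1; lra|].
  rewrite Rabs_mult. specialize (Hx k).
  apply Rmult_le_compat; try apply Rabs_pos; [apply Rabs_le; lra|exact IH].
Qed.

(** Two points of [0, 1/2] are at distance at most [1/2], so the series is dominated by
    [1/20] times the geometric series of ratio [1/2]. *)
Lemma newton_real_value t s :
  0 <= t <= 1 / 2 ->
  Cseries (fun k => RtoC (b k) * Cnodal x k (RtoC t))%C s ->
  exists u : R, s = RtoC u /\ Rabs u <= 1 / 10.
Proof.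
  intros Ht Hs.
  assert (B : forall n,
    Cmod (Csum (fun k => RtoC (b k) * Cnodal x k (RtoC t))%C n - RtoC 0)%C <= 1 / 10).
  { intros n. unfold Cminus. rewrite Copp_0, Cplus_0_r.
    apply (Rle_trans _ (sum_n (fun k => 1 / 20 * (1 / 2) ^ k) n)).
    - apply Cmod_Csum. intros k. rewrite Cnodal_RtoC, Cmod_mult, !Cmod_R.
      apply Rmult_le_compat; try apply Rabs_pos; [apply Hb|now apply nodal_bound].
    - assert (S : sum_n (fun k => 1 / 20 * (1 / 2) ^ k) n = 1 / 10 - 1 / 20 * (1 / 2) ^ n).
      { induction n as [|n IH]; [rewrite Rsum_0; simpl; lra|].
        rewrite Rsum_S, IH. simpl. lra. }
      assert (P := half_pow_pos n). lra. }
  assert (Hle := Cseries_dist_le _ _ _ _ 0 Hs (fun n _ => B n)).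
  assert (HI : Im s = 0).
  { destruct (Req_dec (Im s) 0) as [H0|H0]; [exact H0|exfalso].
    assert (Hp := Rabs_pos_lt _ H0).
    destruct (proj1 (Cseries_eps _ _) Hs (Rabs (Im s)) Hp) as [N HN].
    specialize (HN N (Nat.le_refl _)). rewrite newton_partial_sum in HN.
    set (r := sum_n _ N) in HN.
    assert (K := Rmax_Cmod (RtoC r - s)%C).
    assert (K2 := Rmax_r (Rabs (fst (RtoC r - s)%C)) (Rabs (snd (RtoC r - s)%C))).
    simpl in K2, K. replace (0 + - snd s) with (- Im s) in K, K2 by (unfold Im; ring).
    rewrite Rabs_Ropp in K, K2. lra. }
  exists (Re s).
  assert (Es : s = RtoC (Re s)) by (destruct s as [s1 s2]; simpl in *; subst; reflexivity).
  split; [exact Es|].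
  unfold Cminus in Hle. rewrite Copp_0, Cplus_0_r, Es, Cmod_R in Hle. exact Hle.
Qed.

Lemma nodal_vanish k j : (k < j)%nat -> nodal x j (x k) = 0.
Proof.
  induction 1 as [|j H IH]; simpl; [ring|]. rewrite IH. ring.
Qed.

Lemma newton_value_at_node k s :
  Cseries (fun j => RtoC (b j) * Cnodal x j (RtoC (x k)))%C s ->
  s = RtoC (sum_n (fun j => b j * nodal x j (x k)) k).
Proof.
  intros Hs. apply (Cseries_unique _ _ _ Hs). apply Cseries_eps.
  intros eps Heps. exists k. intros n Hn.
  replace (Csum _ n) with (RtoC (sum_n (fun j => b j * nodal x j (x k)) k)).
  - unfold Cminus. rewrite Cplus_opp_r, Cmod_0. exact Heps.
  - rewrite newton_partial_sum. f_equal. induction Hn as [|n Hn IH]; [reflexivity|].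
    rewrite Rsum_S, <- IH, nodal_vanish, Rmult_0_r by lia. symmetry. apply Rplus_0_r.
Qed.
End RealPoints.

(** * Choosing the angle together with the Newton coefficients *)

(** A pair [e = (q, p)] stands for the requirement that [q * theta - p] be the value of
    [t * interp l theta t] at the node [t = (1 / 2) ^ q]. *)
Definition node (e : nat * Z) : R := (1 / 2) ^ fst e.

Fixpoint node_prod (l : list (nat * Z)) (t : R) : R :=
  match l with nil => 1 | e :: l => (t - node e) * node_prod l t end.

(** The Newton coefficient which makes a function with value [s] at the new node, where
    the nodal polynomial is [w], satisfy the requirement [e]. *)
Definition next_coef (e : nat * Z) (theta s w : R) : R :=
  ((INR (fst e) * theta - IZR (snd e)) / node e - s) / w.

(** The Newton polynomial, latest node first, that satisfies the requirements of [l] for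
    the angle [theta] after multiplication by [t].  It is the dependence on [theta] that
    matters: the angle is known only at the end, so the coefficients are functions of it. *)
Fixpoint interp (l : list (nat * Z)) (theta t : R) : R :=
  match l with
  | nil => 1
  | e :: l => interp l theta t
      + next_coef e theta (interp l theta (node e)) (node_prod l (node e)) * node_prod l t
  end.

Definition coef (e : nat * Z) (l : list (nat * Z)) (theta : R) : R :=
  next_coef e theta (interp l theta (node e)) (node_prod l (node e)).

Lemma continuity_cst (c : R) : continuity (fun _ => c).
Proof. apply continuity_const. intros a b. reflexivity. Qed.

Lemma interp_continuous l t : continuity (fun theta => interp l theta t).
Proof.
  revert t. induction l as [|e l IH]; intros t; simpl.
  - apply continuity_cst.
  - unfold next_coef, Rdiv.
    apply continuity_plus; [apply IH|].
    apply (continuity_mult _ (fun _ => _)); [|apply continuity_cst].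
    apply (continuity_mult _ (fun _ => _)); [|apply continuity_cst].
    apply continuity_minus; [|apply IH].
    apply (continuity_mult _ (fun _ => _)); [|apply continuity_cst].
    apply continuity_minus; [|apply continuity_cst].
    apply (continuity_mult (fun _ => _) _); [apply continuity_cst|].
    apply derivable_continuous, derivable_id.
Qed.

Lemma coef_continuous e l : continuity (coef e l).
Proof.
  unfold coef, next_coef, Rdiv.
  apply (continuity_mult _ (fun _ => _)); [|apply continuity_cst].
  apply continuity_minus; [|apply interp_continuous].
  apply (continuity_mult _ (fun _ => _)); [|apply continuity_cst].
  apply continuity_minus; [|apply continuity_cst].
  apply (continuity_mult (fun _ => _) _); [apply continuity_cst|].
  apply derivable_continuous, derivable_id.
Qed.

Definition top (l : list (nat * Z)) : nat :=
  match l with nil => 0%nat | e :: _ => fst e end.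

Lemma node_prod_neq_0 l q :
  (forall e, In e l -> (fst e < q)%nat) -> node_prod l ((1 / 2) ^ q) <> 0.
Proof.
  induction l as [|e l IH]; intros H; simpl.
  { exact R1_neq_R0. }
  apply Rmult_integral_contrapositive_currified.
  - assert (K := half_pow_decr (fst e) q (H e (or_introl eq_refl))).
    assert (P := half_pow_pos (fst e)). unfold node. apply Rlt_not_eq. lra.
  - apply IH. intros e' He'. apply H. now right.
Qed.

Lemma node_prod_bound l t : 0 <= t <= 1 / 2 -> Rabs (node_prod l t) <= 1.
Proof.
  intros Ht. induction l as [|e l IH]; simpl; [rewrite Rabs_R1; lra|].
  rewrite Rabs_mult.
  assert (Rabs (t - node e) <= 1).
  { unfold node. assert (P := half_pow_pos (fst e)).
    assert (Q := pow_incr (1 / 2) 1 (fst e) ltac:(lra)). rewrite pow1 in Q.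
    apply Rabs_le. lra. }
  assert (H1 := Rabs_pos (t - node e)). assert (H2 := Rabs_pos (node_prod l t)). nra.
Qed.

Lemma interp_eq e l theta :
  node_prod l (node e) <> 0 ->
  node e * interp (e :: l) theta (node e) = INR (fst e) * theta - IZR (snd e).
Proof.
  intros H. simpl. unfold next_coef. field. split; [|exact H].
  apply Rgt_not_eq, half_pow_pos.
Qed.

(** A state consists of the requirements met so far and of an interval of angles that
    are still possible.  The bound [M] is what the next step has to outgrow. *)
Definition admissible (st : list (nat * Z) * (R * R)) : Prop :=
  let '(l, (u, v)) := st in
  u < v /\ (forall e, In e l -> (fst e <= top l)%nat) /\
  exists M, forall theta t, u <= theta <= v -> 0 <= t <= 1 / 2 -> Rabs (interp l theta t) <= M.

Definition refines (st st' : list (nat * Z) * (R * R)) : Prop :=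
  let '(l, (u, v)) := st in
  let '(l', (u', v')) := st' in
  exists e, l' = e :: l /\ (top l < fst e)%nat /\ u <= u' /\ v' <= v /\
    (forall theta, u' <= theta <= v' -> Rabs (coef e l theta) <= 1 / 20).

(** When [q] is large, [q * theta] runs over a long interval while [theta] runs over
    [u, v], and the value to be interpolated varies by at most [M].  Hence some angle
    [z] and some integer [p] already satisfy the new requirement with coefficient 0,
    and by continuity the coefficient stays small for angles close to [z]. *)
Lemma refinement st : admissible st -> exists st', admissible st' /\ refines st st'.
Proof.
  destruct st as [l [u v]]. intros [Huv [Htop [M HM]]].
  destruct (INR_unbounded (2 * (M + 1) / (v - u))) as [q0 Hq0].
  (* As [x <= 1/2], the term [x * interp l theta x] below varies by at most [M]; the
     remaining growth of [g] over the interval exceeds 1, which leaves room for [p]. *)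
  set (q := S (max q0 (top l))).
  assert (Hq : INR q * (v - u) > 2 * (M + 1)).
  { assert (H : INR q0 <= INR q) by (apply le_INR; lia).
    apply (Rlt_le_trans _ (INR q0 * (v - u))); [|apply Rmult_le_compat_r; lra].
    apply (Rmult_lt_compat_r (v - u)) in Hq0; [|lra].
    unfold Rdiv in Hq0. rewrite Rmult_assoc, Rinv_l, Rmult_1_r in Hq0 by lra. exact Hq0. }
  set (x := (1 / 2) ^ q).
  assert (Hx : 0 < x <= 1 / 2) by (split; [apply half_pow_pos|apply half_pow_le; lia]).
  set (g := fun theta => INR q * theta - x * interp l theta x).
  set (p := up (g u)).
  assert (Hp := archimed (g u)). fold p in Hp.
  assert (Hend : forall th, u <= th <= v -> Rabs (x * interp l th x) <= M / 2).
  { intros th Hth. rewrite Rabs_mult, (Rabs_pos_eq x) by lra.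
    assert (H := HM th x Hth ltac:(lra)). assert (H' := Rabs_pos (interp l th x)). nra. }
  assert (Hu := Hend u ltac:(lra)). assert (Hv := Hend v ltac:(lra)).
  apply Rabs_le_between in Hu, Hv.
  assert (Hg : g u + 1 < g v) by (unfold g; lra).
  destruct (IVT (fun theta => g theta - IZR p) u v) as [z [Hz Hgz]].
  - apply continuity_minus; [|apply continuity_cst].
    unfold g. apply continuity_minus.
    + apply (continuity_mult (fun _ => _) _); [apply continuity_cst|].
      apply derivable_continuous, derivable_id.
    + apply (continuity_mult (fun _ => _) _); [apply continuity_cst|].
      apply interp_continuous.
  - exact Huv.
  - lra.
  - lra.
  - set (e := (q, p)).
    assert (Hcz : coef e l z = 0).
    { unfold coef, next_coef, e, node. simpl fst. simpl snd. fold x.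
      unfold g in Hgz. replace (INR q * z - IZR p) with (x * interp l z x) by lra.
      unfold Rdiv. replace (x * interp l z x * / x) with (interp l z x) by (field; lra). ring. }
    destruct (coef_continuous e l z (1 / 20)) as [d [Hd Hnear]]; [lra|].
    assert (Hc : forall theta, Rabs (theta - z) < d -> Rabs (coef e l theta) <= 1 / 20).
    { intros theta Hth. destruct (Req_dec theta z) as [->|Hne].
      - rewrite Hcz, Rabs_R0. lra.
      - assert (H : Rdist (coef e l theta) (coef e l z) < 1 / 20).
        { apply Hnear. split; [split; [exact I|auto]|exact Hth]. }
        unfold Rdist in H. rewrite Hcz, Rminus_0_r in H. lra. }
    assert (Hfe : (top l < fst e)%nat) by (simpl; lia).
    exists (e :: l, (Rmax u (z - d / 2), Rmin v (z + d / 2))).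
    assert (Hcc : forall theta, Rmax u (z - d / 2) <= theta <= Rmin v (z + d / 2) ->
              Rabs (coef e l theta) <= 1 / 20).
    { intros theta Hth. apply Hc.
      assert (H1 := Rmax_r u (z - d / 2)). assert (H2 := Rmin_r v (z + d / 2)).
      apply Rabs_def1; lra. }
    split.
    + split; [|split].
      * apply Rmax_lub_lt; apply Rmin_glb_lt; lra.
      * intros e' [<-|He']; [simpl; lia|]. apply Htop in He'. simpl in *. lia.
      * exists (M + 1). intros theta t Hth Ht.
        assert (H1 := Rmax_l u (z - d / 2)). assert (H2 := Rmin_l v (z + d / 2)).
        assert (A1 := HM theta t ltac:(lra) Ht). assert (A2 := Hcc theta Hth).
        assert (A3 := node_prod_bound l t Ht).
        simpl. fold (coef e l theta).
        eapply Rle_trans; [apply Rabs_triang|]. rewrite Rabs_mult.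
        assert (B1 := Rabs_pos (coef e l theta)). assert (B2 := Rabs_pos (node_prod l t)). nra.
    + exists e. repeat split; [exact Hfe|apply Rmax_l|apply Rmin_l|exact Hcc].
Qed.

Lemma nested_intervals (u v : nat -> R) :
  (forall k, u k < v k) -> (forall k, u k <= u (S k)) -> (forall k, v (S k) <= v k) ->
  exists theta, forall k, u k <= theta <= v k.
Proof.
  intros Huv Hu Hv.
  assert (Mu : forall k j, u k <= u (k + j)%nat).
  { intros k. induction j as [|j IH]; [rewrite Nat.add_0_r; lra|].
    rewrite Nat.add_succ_r. specialize (Hu (k + j)%nat). lra. }
  assert (Mv : forall k j, v (k + j)%nat <= v k).
  { intros k. induction j as [|j IH]; [rewrite Nat.add_0_r; lra|].
    rewrite Nat.add_succ_r. specialize (Hv (k + j)%nat). lra. }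
  assert (Muv : forall k j, u k <= v j).
  { intros k j. specialize (Mu k j). specialize (Mv j k). rewrite Nat.add_comm in Mv.
    specialize (Huv (k + j)%nat). lra. }
  destruct (completeness (fun y => exists k, y = u k)) as [theta [H1 H2]].
  - exists (v 0%nat). intros y [k ->]. apply Muv.
  - exists (u 0%nat). now exists 0%nat.
  - exists theta. intros k. split.
    + apply H1. now exists k.
    + apply H2. intros y [j ->]. apply Muv.
Qed.

(** Iterating the refinement step, the angle is a common point of the nested
    intervals, and the coefficients are the functions [coef] at this angle. *)
Lemma diophantine_interpolation :
  exists (theta : R) (q : nat -> nat) (p : nat -> Z) (b : nat -> R),
    let x k := (1 / 2) ^ q k in
    (forall k, (k < q k)%nat) /\
    (forall k, Rabs (b k) <= 1 / 20) /\
    (forall k, INR (q k) * theta - IZR (p k)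
               = x k * (1 + sum_n (fun j => b j * nodal x j (x k)) k)).
Proof.
  destruct (choice (fun st st' => admissible st -> admissible st' /\ refines st st'))
    as [next Hnext].
  { intros st. destruct (excluded_middle_informative (admissible st)) as [H|H].
    - destruct (refinement st H) as [st' H']. exists st'. auto.
    - exists st. intros; contradiction. }
  set (st := fun k => Nat.iter k next (nil, (0, 1))).
  assert (Hst : forall k, admissible (st k)).
  { induction k as [|k IH].
    - split; [lra|]. split; [intros e []|]. exists 1. intros. simpl. rewrite Rabs_R1. lra.
    - now apply Hnext. }
  assert (Href : forall k, refines (st k) (st (S k))) by (intros k; now apply Hnext).
  set (l := fun k => fst (st k)). set (u := fun k => fst (snd (st k))).
  set (v := fun k => snd (snd (st k))).
  assert (Hl : forall k, exists e, l (S k) = e :: l k /\ (top (l k) < fst e)%nat /\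
     forall theta, u (S k) <= theta <= v (S k) -> Rabs (coef e (l k) theta) <= 1 / 20).
  { intros k. specialize (Href k). unfold l, u, v.
    destruct (st k) as [l0 [u0 v0]], (st (S k)) as [l1 [u1 v1]].
    destruct Href as [e [H1 [H2 [_ [_ H3]]]]]. exists e. auto. }
  destruct (nested_intervals u v) as [theta Htheta].
  { intros k. specialize (Hst k). unfold u, v. destruct (st k) as [l0 [u0 v0]]. apply Hst. }
  { intros k. specialize (Href k). unfold u. destruct (st k) as [l0 [u0 v0]], (st (S k)) as [l1 [u1 v1]].
    destruct Href as [e [_ [_ [H _]]]]. exact H. }
  { intros k. specialize (Href k). unfold v. destruct (st k) as [l0 [u0 v0]], (st (S k)) as [l1 [u1 v1]].
    destruct Href as [e [_ [_ [_ [H _]]]]]. exact H. }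
  destruct (choice _ Hl) as [e He].
  set (q := fun k => fst (e k)). set (x := fun k => (1 / 2) ^ q k).
  set (b := fun k => coef (e k) (l k) theta).
  exists theta, q, (fun k => snd (e k)), b.
  assert (l0 : l 0%nat = nil) by reflexivity.
  assert (Hprod : forall k t, node_prod (l k) t = nodal x k t).
  { induction k as [|k IH]; intros t; [now rewrite l0|].
    destruct (He k) as [-> _]. simpl. now rewrite IH. }
  assert (Hint : forall k t, interp (l (S k)) theta t = 1 + sum_n (fun j => b j * nodal x j t) k).
  { assert (Hstep : forall k t, interp (l (S k)) theta t = interp (l k) theta t + b k * nodal x k t).
    { intros k t. destruct (He k) as [-> _]. rewrite <- Hprod. reflexivity. }
    induction k as [|k IH]; intros t; rewrite Hstep.
    - rewrite l0, Rsum_0. reflexivity.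
    - rewrite IH, Rsum_S. ring. }
  repeat split.
  - induction k as [|k IH].
    + destruct (He 0%nat) as [_ [H _]]. unfold q. lia.
    + destruct (He (S k)) as [_ [H _]]. destruct (He k) as [E _]. rewrite E in H.
      simpl in H. unfold q in *. lia.
  - intros k. apply (He k). apply Htheta.
  - intros k. change (x k) with (node (e k)). rewrite <- Hint.
    destruct (He k) as [E [Hq _]]. rewrite E. symmetry. apply interp_eq.
    apply node_prod_neq_0. intros e' He'.
    specialize (Hst k). unfold l in *. destruct (st k) as [lk [uk vk]].
    destruct Hst as [_ [H _]]. apply H in He'. simpl in *. lia.
Qed.

(** * Gaps and iterated logarithms *)

Lemma count_S A n : count A (S n) = (count A n +
  if excluded_middle_informative (A (S n)) then 1 else 0)%nat.
Proof.
  unfold count. rewrite (seq_S (S n)), filter_app, length_app. simpl (0 + S n)%nat.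
  f_equal. simpl. destruct (excluded_middle_informative (A (S n))); reflexivity.
Qed.

Lemma count_mono A n m : (n <= m)%nat -> (count A n <= count A m)%nat.
Proof. induction 1; [lia|]. rewrite count_S. lia. Qed.

Lemma count_le A n : (count A n <= S n)%nat.
Proof.
  unfold count. eapply Nat.le_trans; [apply filter_length_le|]. now rewrite length_seq.
Qed.

Lemma count_stable A n m :
  (n <= m)%nat -> (forall a, A a -> (n < a <= m)%nat -> False) -> count A m = count A n.
Proof.
  intros H. induction H as [|m H IH]; intros HA; [reflexivity|].
  rewrite count_S, IH.
  - destruct (excluded_middle_informative (A (S m))) as [K|K]; [|lia].
    exfalso. apply (HA _ K). lia.
  - intros a Ha Hr. apply (HA a Ha). lia.
Qed.

(** Only the largest element of [A] up to [n] can exceed [k]. *)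
Lemma count_gap A n k :
  (forall a a', A a -> A a' -> (a < a' <= n)%nat -> (a <= k)%nat) ->
  (count A n <= 1 + count A k)%nat.
Proof.
  induction n as [|n IH]; intros H.
  - assert (K := count_le A 0). lia.
  - rewrite count_S. destruct (excluded_middle_informative (A (S n))) as [K|K].
    + assert (count A n <= count A k)%nat; [|lia].
      destruct (Nat.le_gt_cases n k) as [Hn|Hn]; [now apply count_mono|].
      rewrite (count_stable A k n); [lia|lia|].
      intros a Ha Hr. specialize (H a (S n) Ha K ltac:(lia)). lia.
    + assert (count A n <= 1 + count A k)%nat; [|lia].
      apply IH. intros a a' Ha Ha' Hr. apply (H a a'); auto. lia.
Qed.

Lemma iter_log_S m x : iter_log (S m) x = ln (iter_log m x).
Proof. reflexivity. Qed.

Lemma iter_log_comm m x : iter_log m (ln x) = iter_log (S m) x.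
Proof.
  induction m as [|m IH]; [reflexivity|]. rewrite !iter_log_S, IH. reflexivity.
Qed.

Definition ultimately (P : R -> Prop) : Prop := exists X, forall x, X <= x -> P x.

Lemma ultimately_and P Q : ultimately P -> ultimately Q -> ultimately (fun x => P x /\ Q x).
Proof.
  intros [X HX] [Y HY]. exists (Rmax X Y). intros x Hx. split.
  - apply HX. eapply Rle_trans; [apply Rmax_l|exact Hx].
  - apply HY. eapply Rle_trans; [apply Rmax_r|exact Hx].
Qed.

Lemma ultimately_imp (P Q : R -> Prop) : (forall x, P x -> Q x) -> ultimately P -> ultimately Q.
Proof. intros H [X HX]. exists X. auto. Qed.

Lemma ln_le_mono x y : 0 < x -> x <= y -> ln x <= ln y.
Proof. intros Hx [H| ->]; [left; now apply ln_increasing|lra]. Qed.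

Lemma iter_log_large m B : ultimately (fun x => B <= iter_log m x).
Proof.
  revert B. induction m as [|m IH]; intros B.
  - exists B. auto.
  - apply (ultimately_imp _ _) with (2 := IH (exp B)). intros x Hx.
    rewrite iter_log_S, <- (ln_exp B). apply ln_le_mono; [apply exp_pos|exact Hx].
Qed.

Lemma iter_log_mono m :
  ultimately (fun x => forall y, x <= y -> iter_log m x <= iter_log m y).
Proof.
  induction m as [|m IH].
  - exists 0. auto.
  - apply (ultimately_imp _ _) with (2 := ultimately_and _ _ IH (iter_log_large m 1)).
    intros x [H1 H2] y Hy. rewrite !iter_log_S. apply ln_le_mono; [lra|auto].
Qed.

(** The gaps are governed by the logarithm in base 2, bounded here by [4 * ln n]; an
    iterated logarithm absorbs such a factor, as [4 * y <= y ^ 4] for [y >= 2]. *)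
Lemma iter_log_dilate m :
  ultimately (fun x => iter_log m (4 * x) <= 4 * iter_log m x).
Proof.
  induction m as [|m IH].
  - exists 0. intros x _. apply Rle_refl.
  - destruct (ultimately_and _ _ IH (ultimately_and _ _ (iter_log_large m 2) (iter_log_mono m)))
      as [X HX].
    exists (Rmax X 0). intros x Hx.
    assert (HxX : X <= x) by (eapply Rle_trans; [apply Rmax_l|exact Hx]).
    assert (Hx0 : 0 <= x) by (eapply Rle_trans; [apply Rmax_r|exact Hx]).
    destruct (HX x HxX) as [H1 [H2 H3]].
    specialize (H3 (4 * x) ltac:(lra)). rewrite !iter_log_S.
    set (y := iter_log m x) in *. set (z := iter_log m (4 * x)) in *.
    replace (4 * ln y) with (ln (y ^ 4)) by (rewrite ln_pow by lra; simpl; ring).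
    apply ln_le_mono; [lra|].
    assert (0 <= y * (y ^ 3 - 4)); [|nra].
    apply Rmult_le_pos; [lra|]. simpl. nra.
Qed.

Section Gap.
Variable A : nat -> Prop.
Hypothesis HA : forall a a', A a -> A a' -> (a < a')%nat -> 2 ^ a <= 2 * INR a'.

Lemma count_gap_log (n k : nat) :
  (2 <= n)%nat -> 4 * ln (INR n) < INR k + 1 -> (count A n <= 1 + count A k)%nat.
Proof.
  intros Hn Hk. apply count_gap. intros a a' Ha Ha' Hr.
  assert (H := HA a a' Ha Ha' ltac:(lia)).
  assert (H1 : INR a' <= INR n) by (apply le_INR; lia).
  assert (H2 : 2 <= INR n) by (apply (le_INR 2) in Hn; simpl in Hn; lra).
  assert (H3 : ln (2 ^ a) <= ln (INR n ^ 2)).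
  { apply ln_le_mono; [apply pow_lt; lra|]. simpl. nra. }
  rewrite !ln_pow in H3 by lra. simpl in H3.
  assert (Ha2 : INR a <= 4 * ln (INR n)).
  { assert (L := ln_lt_2). assert (P := pos_INR a). nra. }
  apply INR_le. assert (INR a < INR (S k)) by (rewrite S_INR; lra).
  apply INR_lt in H0. apply le_INR. lia.
Qed.

(** Each step trades one element of [A] for one logarithm: up to [n] there is at most
    one more element than up to [4 * ln n]. *)
Lemma count_le_iter_log m :
  exists C N, 0 < C /\ forall n, (N <= n)%nat -> INR (count A n) <= C * iter_log m (INR n).
Proof.
  induction m as [|m [C [N [HC HN]]]].
  - exists 2, 1%nat. split; [lra|]. intros n Hn.
    assert (H := count_le A n). apply le_INR in H. rewrite S_INR in H.
    apply le_INR in Hn. simpl in *. lra.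
  - destruct (ultimately_and _ _ (iter_log_mono m)
                (ultimately_and _ _ (iter_log_dilate m) (iter_log_large m 1))) as [X HX].
    destruct (iter_log_large 1 (Rmax X (INR N + 1))) as [Y HY].
    destruct (INR_unbounded (Rmax Y 2)) as [N' HN'].
    exists (1 + 4 * C), N'. split; [lra|]. intros n Hn.
    apply le_INR in Hn.
    assert (HnY : Y <= INR n) by (assert (K := Rmax_l Y 2); lra).
    assert (Hn2 : 2 <= INR n) by (assert (K := Rmax_r Y 2); lra).
    specialize (HY _ HnY). change (iter_log 1 (INR n)) with (ln (INR n)) in HY.
    set (y := ln (INR n)) in *.
    assert (HyX : X <= y) by (assert (K := Rmax_l X (INR N + 1)); lra).
    assert (HyN : INR N + 1 <= y) by (assert (K := Rmax_r X (INR N + 1)); lra).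
    assert (PN := pos_INR N).
    destruct (nfloor_ex (4 * y)) as [k [Hk1 Hk2]]; [lra|].
    assert (Hyk : y <= INR k) by lra.
    assert (HNk : (N <= k)%nat) by (apply INR_le; lra).
    assert (Hc : (count A n <= 1 + count A k)%nat).
    { apply count_gap_log; [apply INR_le; simpl; lra|exact Hk2]. }
    apply le_INR in Hc. rewrite plus_INR in Hc. simpl in Hc.
    specialize (HN k HNk).
    destruct (HX _ (Rle_trans _ _ _ HyX Hyk)) as [M1 _]. specialize (M1 _ Hk1).
    destruct (HX _ HyX) as [_ [M2 M3]].
    rewrite <- iter_log_comm. fold y.
    assert (C * iter_log m (INR k) <= C * (4 * iter_log m y))
      by (apply Rmult_le_compat_l; lra). lra.
Qed.

(** One further logarithm turns the domination into a little-o. *)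
Lemma very_sparse_of_gaps : very_sparse A.
Proof.
  intros m _ eps.
  destruct (count_le_iter_log (S m)) as [C [N [HC HN]]].
  assert (Heps := cond_pos eps).
  assert (L : ultimately (fun x => C * ln x <= eps * x)).
  { assert (L := is_lim_div_ln_p). apply is_lim_spec in L.
    destruct (L (mkposreal (eps / C) ltac:(apply Rdiv_lt_0_compat; lra))) as [X HX].
    exists (Rmax X 0 + 1). intros x Hx.
    assert (K1 := Rmax_l X 0). assert (K2 := Rmax_r X 0).
    specialize (HX x ltac:(lra)). simpl in HX. rewrite Rminus_0_r in HX.
    apply Rabs_def2 in HX. destruct HX as [HX _].
    apply (Rmult_lt_compat_r (C * x)) in HX; [|nra].
    replace (ln x / x * (C * x)) with (C * ln x) in HX by (field; lra).
    replace (eps / C * (C * x)) with (eps * x) in HX by (field; lra). lra. }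
  destruct L as [X HX].
  destruct (iter_log_large m (Rmax X 0)) as [Y HY].
  destruct (INR_unbounded Y) as [N' HN'].
  exists (max N N'). intros n Hn.
  assert (HnY : Y <= INR n).
  { assert (K : INR N' <= INR n) by (apply le_INR; lia). lra. }
  specialize (HY _ HnY). specialize (HN n ltac:(lia)).
  assert (K1 := Rmax_l X 0). assert (K2 := Rmax_r X 0).
  specialize (HX (iter_log m (INR n)) ltac:(lra)).
  rewrite iter_log_S in HN.
  change (Rabs (INR (count A n)) <= eps * Rabs (iter_log m (INR n))).
  rewrite (Rabs_pos_eq (iter_log m (INR n))), (Rabs_pos_eq (INR (count A n))) by (lra || apply pos_INR). lra.
Qed.
End Gap.

Lemma infinite_of_unbounded (A : nat -> Prop) :
  (forall N, exists n, (N < n)%nat /\ A n) -> infinite A.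
Proof.
  intros H HF.
  assert (B : exists N, forall n, A n -> (n <= N)%nat).
  { clear H. induction HF as [|A' HF [N IH] x Hx].
    - exists 0%nat. intros n Hn. destruct Hn.
    - exists (max N x). intros n Hn. destruct Hn as [n Hn|n Hn].
      + apply IH in Hn. lia.
      + destruct Hn. lia. }
  destruct B as [N HN]. destruct (H N) as [n [Hn An]]. apply HN in An. lia.
Qed.

(** * Close returns of a rotation *)

Definition close_return (theta : R) (n : nat) : Prop :=
  exists p : Z, 9 / 10 * (1 / 2) ^ n <= INR n * theta - IZR p <= 11 / 10 * (1 / 2) ^ n.

Lemma INR_half_pow n : INR n * (1 / 2) ^ n <= 1 / 2.
Proof.
  induction n as [|n IH]; [simpl; lra|].
  destruct n as [|n]; [simpl; lra|].
  rewrite !S_INR in *. simpl pow in *.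
  assert (H := half_pow_pos n). assert (K := pos_INR n).
  assert (0 <= INR n * (1 / 2) ^ n) by (apply Rmult_le_pos; lra). lra.
Qed.

(** Write [d] and [d'] for the two remainders.  The integer [n' * p - n * p'] equals
    [n * d' - n' * d]; it is negative because [d'] is at most about half of [d] while
    [n < n'].  Hence [n' * d >= 1], and [d] is about [(1 / 2) ^ n].  The lower bound on
    remainders is essential: it excludes multiples of a single good denominator. *)
Lemma close_return_gap theta n n' :
  close_return theta n -> close_return theta n' -> (n < n')%nat -> 2 ^ n <= 2 * INR n'.
Proof.
  intros [p Hp] [p' Hp'] Hn.
  set (d := INR n * theta - IZR p) in *. set (d' := INR n' * theta - IZR p') in *.
  assert (E : INR n * d' - INR n' * d = IZR (Z.of_nat n' * p - Z.of_nat n * p')).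
  { unfold d, d'. rewrite minus_IZR, !mult_IZR, <- !INR_IZR_INZ. ring. }
  set (D := (Z.of_nat n' * p - Z.of_nat n * p')%Z) in *.
  assert (H := half_pow_decr n n' Hn).
  assert (Hd := INR_half_pow n). assert (P := half_pow_pos n).
  assert (Pn := pos_INR n).
  assert (Hnn : INR n + 1 <= INR n') by (rewrite <- S_INR; apply le_INR; lia).
  assert (Hnd' : INR n * d' <= 11 / 20 * (INR n * (1 / 2) ^ n)).
  { assert (d' <= 11 / 20 * (1 / 2) ^ n) by lra. nra. }
  assert (Hn'd : (INR n + 1) * (9 / 10 * (1 / 2) ^ n) <= INR n' * d).
  { apply Rmult_le_compat; lra. }
  assert (P' := half_pow_pos n').
  assert (Hpos : 0 <= INR n * d') by (apply Rmult_le_pos; lra).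
  assert (HD : IZR D < 0) by nra.
  apply lt_IZR in HD. assert (HD1 : (D <= -1)%Z) by lia. apply IZR_le in HD1.
  assert (1 <= INR n' * (11 / 10 * (1 / 2) ^ n)).
  { assert (INR n' * d <= INR n' * (11 / 10 * (1 / 2) ^ n)) by (apply Rmult_le_compat_l; lra).
    lra. }
  assert (Q : 2 ^ n * (1 / 2) ^ n = 1).
  { rewrite <- Rpow_mult_distr. replace (2 * (1 / 2)) with 1 by lra. apply pow1. }
  assert (P2 : 0 < 2 ^ n) by (apply pow_lt; lra).
  assert (2 ^ n * 1 <= 2 ^ n * (INR n' * (11 / 10 * (1 / 2) ^ n)))
    by (apply Rmult_le_compat_l; lra).
  replace (2 ^ n * (INR n' * (11 / 10 * (1 / 2) ^ n)))
    with (INR n' * (11 / 10) * (2 ^ n * (1 / 2) ^ n)) in H1 by ring.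
  rewrite Q in H1. lra.
Qed.

(** For a rational angle of denominator [B], the positive remainders of [n * theta] are
    at least [1 / B]. *)
Lemma irrational_of_close_returns theta :
  (forall N, exists n, (N < n)%nat /\ close_return theta n) -> irrational theta.
Proof.
  intros H [a b] E. unfold Q2R in E. simpl in E.
  set (B := IZR (Z.pos b)) in *.
  assert (HB : 0 < B) by (apply IZR_lt; lia).
  destruct (INR_unbounded (2 * B)) as [N HN].
  destruct (H N) as [n [Hn [p Hp]]].
  assert (HnB : 2 * B < INR n) by (apply lt_INR in Hn; lra).
  assert (EI : B * (INR n * theta - IZR p) = IZR (Z.of_nat n * a - Z.pos b * p)).
  { rewrite E, minus_IZR, !mult_IZR, <- INR_IZR_INZ. fold B. field. lra. }
  assert (P := half_pow_pos n). assert (K := INR_half_pow n).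
  assert (L : 0 < IZR (Z.of_nat n * a - Z.pos b * p)) by (rewrite <- EI; nra).
  apply lt_IZR in L. assert (L1 : (1 <= Z.of_nat n * a - Z.pos b * p)%Z) by lia.
  apply IZR_le in L1. rewrite <- EI in L1. nra.
Qed.

(** * Points of the unit circle *)

Lemma rotation_pow theta n :
  ((RtoC (1 / 2) * Cexp (RtoC (2 * PI) * Ci * RtoC theta)) ^ n)%C =
  (RtoC ((1 / 2) ^ n) * (cos (2 * PI * (INR n * theta)), sin (2 * PI * (INR n * theta))))%C.
Proof.
  assert (E : Cexp (RtoC (2 * PI) * Ci * RtoC theta) = (cos (2 * PI * theta), sin (2 * PI * theta))).
  { unfold Cexp. simpl. 
    replace ((2 * PI * 0 - 0 * 1) * theta - (2 * PI * 1 + 0 * 0) * 0) with 0 by ring.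
    replace ((2 * PI * 0 - 0 * 1) * 0 + (2 * PI * 1 + 0 * 0) * theta) with (2 * PI * theta) by ring.
    rewrite exp_0. apply Cmult_1_l. }
  rewrite E. clear E. induction n as [|n IH].
  - simpl. rewrite Rmult_0_l, Rmult_0_r, cos_0, sin_0. apply injective_projections; simpl; ring.
  - rewrite Cpow_S, IH, S_INR.
    replace (2 * PI * ((INR n + 1) * theta)) with (2 * PI * theta + 2 * PI * (INR n * theta)) by ring.
    rewrite cos_plus, sin_plus. apply injective_projections; simpl; ring.
Qed.

Lemma circle_eq_integer a b :
  cos (2 * PI * a) = cos (2 * PI * b) -> sin (2 * PI * a) = sin (2 * PI * b) ->
  exists k : Z, a - b = IZR k.
Proof.
  intros Hc Hs.
  assert (H : cos (2 * (PI * (a - b))) = 1).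
  { replace (2 * (PI * (a - b))) with (2 * PI * a - 2 * PI * b) by ring.
    rewrite cos_minus, Hc, Hs. assert (K := sin2_cos2 (2 * PI * b)). unfold Rsqr in K. lra. }
  rewrite cos_2a_sin in H.
  assert (S0 : sin (PI * (a - b)) = 0) by nra.
  apply sin_eq_0_0 in S0. destruct S0 as [k Hk]. exists k.
  assert (P := PI_RGT_0). apply (Rmult_eq_reg_l PI); lra.
Qed.

Lemma circle_shift a (p : Z) :
  cos (2 * PI * (a - IZR p)) = cos (2 * PI * a) /\ sin (2 * PI * (a - IZR p)) = sin (2 * PI * a).
Proof.
  assert (S0 : sin (IZR p * PI) = 0) by (apply sin_eq_0_1; now exists p).
  assert (C2 : cos (2 * (IZR p * PI)) = 1) by (rewrite cos_2a_sin, S0; ring).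
  assert (S2 : sin (2 * (IZR p * PI)) = 0) by (rewrite sin_2a, S0; ring).
  replace (2 * PI * (a - IZR p)) with (2 * PI * a - 2 * (IZR p * PI)) by ring.
  rewrite cos_minus, sin_minus, C2, S2. split; ring.
Qed.

(** * The function and its coincidence set *)

Theorem proposition1p4 :
  exists (theta : R) (f : C -> C),
    irrational theta /\
    analytic_on_unit_disc f /\
    (let a1 : C := RtoC (1 / 2) in
     let a2 : C := (RtoC (1 / 2) * Cexp (RtoC (2 * PI) * Ci * RtoC theta))%C in
     let A : nat -> Prop := fun n => (0 < n)%nat /\ f (a1 ^ n)%C = (a2 ^ n)%C in
     infinite A /\ very_sparse A).
Proof.
  destruct diophantine_interpolation as [theta [q [p [b [Hq [Hb Heq]]]]]].
  set (x := fun k => (1 / 2) ^ q k) in *.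
  assert (Hx : forall k, 0 < x k <= 1 / 2).
  { intros k. specialize (Hq k). split; [apply half_pow_pos|apply half_pow_le; lia]. }
  assert (Hx0 : is_lim_seq x 0).
  { apply (is_lim_seq_le_le (fun _ => 0) x (fun k => (1 / 2) ^ k)).
    - intros k. split; [apply Rlt_le, Hx|].
      assert (H := half_pow_decr k (q k) (Hq k)). assert (H' := half_pow_pos k).
      unfold x. lra.
    - apply is_lim_seq_const.
    - apply is_lim_seq_geom. rewrite Rabs_pos_eq; lra. }
  destruct (newton_exponential x b) as [s [f [Hs [Hf Hval]]]].
  { intros i. apply Hx. }
  { exact Hx0. }
  { intros k. specialize (Hb k). lra. }
  assert (Hdisc : forall n, (0 < n)%nat -> 0 <= (1 / 2) ^ n <= 1 / 2).
  { intros n Hn. split; [apply Rlt_le, half_pow_pos|now apply half_pow_le]. }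
  assert (Hser : forall t, 0 <= t <= 1 / 2 ->
            Cseries (fun k => RtoC (b k) * Cnodal x k (RtoC t))%C (s (RtoC t))).
  { intros t Ht. apply Hs. rewrite Cmod_R, Rabs_pos_eq; lra. }
  assert (HA : forall n, (0 < n)%nat ->
     f (RtoC (1 / 2) ^ n)%C = ((RtoC (1 / 2) * Cexp (RtoC (2 * PI) * Ci * RtoC theta)) ^ n)%C ->
     close_return theta n).
  { intros n Hn E. rewrite <- RtoC_pow, rotation_pow in E.
    assert (Ht := Hdisc n Hn).
    destruct (newton_real_value x b Hx Hb _ _ Ht (Hser _ Ht)) as [u [Hu Hu10]].
    rewrite (Hval _ _ Hu) in E.
    assert (P := half_pow_pos n).
    assert (Ec : cos (2 * PI * ((1 / 2) ^ n * (1 + u))) = cos (2 * PI * (INR n * theta))).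
    { assert (E1 := f_equal fst E). simpl in E1. apply (Rmult_eq_reg_l ((1 / 2) ^ n)); lra. }
    assert (Es : sin (2 * PI * ((1 / 2) ^ n * (1 + u))) = sin (2 * PI * (INR n * theta))).
    { assert (E1 := f_equal snd E). simpl in E1. apply (Rmult_eq_reg_l ((1 / 2) ^ n)); lra. }
    destruct (circle_eq_integer _ _ (eq_sym Ec) (eq_sym Es)) as [k Hk].
    exists k. replace (INR n * theta - IZR k) with ((1 / 2) ^ n * (1 + u)) by lra.
    apply Rabs_le_between in Hu10. split; nra. }
  assert (HAq : forall k,
     f (RtoC (1 / 2) ^ q k)%C = ((RtoC (1 / 2) * Cexp (RtoC (2 * PI) * Ci * RtoC theta)) ^ q k)%C).
  { intros k. rewrite <- RtoC_pow, rotation_pow. fold (x k).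
    assert (Ht : 0 <= x k <= 1 / 2) by (specialize (Hx k); lra).
    rewrite (Hval _ _ (newton_value_at_node x b k _ (Hser _ Ht))).
    replace (x k * _) with (INR (q k) * theta - IZR (p k)) by exact (Heq k).
    destruct (circle_shift (INR (q k) * theta) (p k)) as [-> ->]. reflexivity. }
  exists theta, f. split; [|split; [exact Hf|]].
  - apply irrational_of_close_returns. intros N. exists (q N). split; [apply Hq|].
    apply HA; [specialize (Hq N); lia|apply HAq].
  - intros a1 a2 A. split.
    + apply infinite_of_unbounded. intros N. exists (q N). split; [apply Hq|].
      split; [specialize (Hq N); lia|apply HAq].
    + apply very_sparse_of_gaps. intros a a' [Ha0 Ha] [Ha0' Ha'] Hlt.
      apply (close_return_gap theta); auto.
Qed.
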